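(* There is an absolute constant $c>0$ such that for all $n$ and all $\varepsilon$ with $c>\varepsilon\ge 2^{-n}$, any non-adaptive one-sided $\varepsilon$-testing algorithm for whether an unknown $f:\{0,1\}^n\to\{0,1\}$ is intersecting versus $\varepsilon$-far from intersecting must make $2^{\Omega(\sqrt{n\log(1/\varepsilon)})}$ queries to $f$.
   Context: Identify $x\in\{0,1\}^n$ with the subset $\{i:x_i=1\}$ of $[n]$. A function $f:\{0,1\}^n\to\{0,1\}$ is intersecting if whenever $f(x)=f(y)=1$ there is $i$ with $x_i=y_i=1$. The distance between $f,g$ is $\Pr_{\mathbf{x}}[f(\mathbf{x})\ne g(\mathbf{x})]$ for uniform $\mathbf{x}$; $f$ is $\varepsilon$-far from intersecting if its distance to every intersecting function is at least $\varepsilon$. An $\varepsilon$-testing algorithm accepts with probability at least $2/3$ every intersecting $f$ and rejects with probability at least $2/3$ every $f$ that is $\varepsilon$-far from intersecting; it is one-sided if it accepts every intersecting function with probability $1$, and non-adaptive if its queries do not depend on answers to earlier queries. *)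

(* Defs.v *)
From mathcomp Require Import all_boot all_order all_algebra.
From mathcomp Require Import all_classical all_reals all_analysis.

Set Implicit Arguments.
Unset Strict Implicit.
Unset Printing Implicit Defensive.

Import Order.TTheory GRing.Theory Num.Theory.
Local Open Scope classical_set_scope.
Local Open Scope ring_scope.

Definition cube (n : nat) : finType := {ffun 'I_n -> bool}.

(* [x = y] is allowed, so an intersecting [f] vanishes at the empty set. *)
Definition intersecting (n : nat) (f : cube n -> bool) : Prop :=
  forall x y : cube n, f x -> f y -> exists i : 'I_n, x i && y i.

Definition dist (R : realType) (n : nat) (f g : cube n -> bool) : R :=
  #|[set x : cube n | f x != g x]%SET|%:R / #|cube n|%:R.

Definition far_from_intersecting (R : realType) (n : nat) (eps : R)
    (f : cube n -> bool) : Prop :=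
  forall g : cube n -> bool, intersecting g -> eps <= dist R f g.

(* A deterministic, possibly adaptive, query algorithm: in [Ask x k] the point
   [x] is queried and the computation goes on with [k (f x)]; [Output true]
   accepts and [Output false] rejects. *)
Inductive query_tree (n : nat) : Type :=
| Output of bool
| Ask of cube n & (bool -> query_tree n).

Fixpoint run (n : nat) (t : query_tree n) (f : cube n -> bool) : bool :=
  match t with
  | Output b => b
  | Ask x k => run (k (f x)) f
  end.

Fixpoint queries (n : nat) (t : query_tree n) (f : cube n -> bool) :
    seq (cube n) :=
  match t with
  | Output _ => [::]
  | Ask x k => x :: queries (k (f x)) f
  end.

(* A randomized algorithm is a random query tree [A : T -> query_tree n] over a
   probability space [(T, P)]: the sample [w : T] is the internal randomness. *)

Definition accepts (d : measure_display) (T : measurableType d) (n : nat)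
    (A : T -> query_tree n) (f : cube n -> bool) : set T :=
  [set w | run (A w) f = true].

Definition rejects (d : measure_display) (T : measurableType d) (n : nat)
    (A : T -> query_tree n) (f : cube n -> bool) : set T :=
  [set w | run (A w) f = false].

(* The measurability clause is what makes acceptance probabilities meaningful;
   [rejects A f] is then measurable, being the complement of [accepts A f]. *)
Definition tester (R : realType) (d : measure_display) (T : measurableType d)
    (P : probability T R) (n : nat) (eps : R) (A : T -> query_tree n) : Prop :=
  [/\ forall f : cube n -> bool, measurable (accepts A f),
      forall f : cube n -> bool, intersecting f ->
        ((2 / 3)%:E <= P (accepts A f))%E
    & forall f : cube n -> bool, far_from_intersecting eps f ->
        ((2 / 3)%:E <= P (rejects A f))%E].

Definition one_sided (R : realType) (d : measure_display)
    (T : measurableType d) (P : probability T R) (n : nat)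
    (A : T -> query_tree n) : Prop :=
  forall f : cube n -> bool, intersecting f -> P (accepts A f) = 1%E.

(* For fixed internal randomness the queried points are the same whatever the
   answers are. *)
Definition nonadaptive (T : Type) (n : nat) (A : T -> query_tree n) : Prop :=
  forall (w : T) (f g : cube n -> bool), queries (A w) f = queries (A w) g.

(* Worst case over the internal randomness and the input. *)
Definition makes_at_most (T : Type) (n : nat) (q : nat)
    (A : T -> query_tree n) : Prop :=
  forall (w : T) (f : cube n -> bool), (size (queries (A w) f) <= q)%N.

Definition log2 (R : realType) (x : R) : R := ln x / ln 2.

(* Main.v *)
Require Import Defs.
From mathcomp Require Import all_boot all_order all_algebra.
From mathcomp Require Import all_classical all_reals all_analysis.
From mathcomp Require Import measurable_realfun.
From mathcomp Require Import zify ring lra.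

(* A one-sided non-adaptive tester can reject [f] only if it has queried two
   disjoint points at which [f] is 1: otherwise [f] restricted to the queried
   points is intersecting and gets the same answers.  It therefore suffices to
   hide the disjoint pairs of a far function.  For a subset [L] of [n] let [f_L]
   be the indicator of the sets [x] with [|x & L| >= |L|/2 - m] and
   [|x| <= n/2 - 7m], where [m] is of order [sqrt (n log (1/eps))].
   If [x], [y] are disjoint and both belong to [f_L], then [x] and [y] together
   miss at least [14m] points, of which at most [2m] lie in [L]; for fixed [x],
   [y] and uniform [L] this has probability at most [14^-m].  On the other hand,
   if [|L| <= n/2], complementing [x] inside [L] and replacing it by a disjoint
   set of the same size outside [L] gives a graph of disjoint pairs, regular on
   each component, on a part of [f_L] of density at least [2 eps], so that every
   intersecting function omits half of that part.  Averaging over [L] gives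
   [2^m <= q]. *)

Set Implicit Arguments.
Unset Strict Implicit.
Unset Printing Implicit Defensive.

Import Order.TTheory GRing.Theory Num.Theory.
Local Open Scope ring_scope.

(** * Independent sets in graphs with equal degrees along each edge *)

(* Discharging: [x] sends [1 / deg x] along each of its edges. *)
Lemma independent_set_le_half (V : finType) (E : rel V) (A I : {set V}) :
    symmetric E -> {in A, forall x, 0 < #|[set y in A | E x y]|}%N ->
    {in A &, forall x y, E x y ->
      #|[set z in A | E x z]| = #|[set z in A | E y z]|} ->
    {in I &, forall x y, ~~ E x y} ->
  (#|A| <= 2 * #|A :\: I|)%N.
Proof.
move=> symE deg_gt0 degE indI.
pose w x : rat := (#|[set y in A | E x y]|%:R)^-1.
have sumw x : x \in A -> \sum_(y in A | E x y) w x = 1.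
  move=> xA; rewrite sumr_const -mulr_natr -[X in X%:R]cardsE mulVf //.
  by rewrite pnatr_eq0 -lt0n deg_gt0.
(* No charge passes between two points of [I], so all that leaves [A :&: I] arrives in [A :\: I],
   where each point receives at most 1 because the two ends of an edge have equal degree. *)
have AI : (#|A :&: I| <= #|A :\: I|)%N.
  rewrite -(ler_nat rat) -!sumr_const.
  rewrite (eq_bigr (fun x => \sum_(y in A | E x y) w y)); last first.
    move=> x /setIP[xA _]; rewrite -(sumw x xA).
    by apply: eq_bigr => y /andP[yA Exy]; rewrite /w (degE x y).
  rewrite [leRHS](eq_bigr (fun y => \sum_(x in A | E y x) w y)); last first.
    by move=> y /setDP[yA _]; rewrite sumw.
  rewrite (exchange_big_dep (mem A)) /=; last by move=> x y _ /andP[].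
  rewrite (bigID (mem I)) /= big1 ?add0r; last first.
    move=> y /andP[yA yI]; apply: big1 => x /and3P[/setIP[_ xI] _ Exy].
    by have := indI _ _ xI yI; rewrite Exy.
  rewrite [leRHS](eq_bigl (fun y => (y \in A) && (y \notin I))); last first.
    by move=> y; rewrite inE andbC.
  apply: ler_sum => y /andP[yA _].
  rewrite [leRHS](bigID (mem I)) /=.
  rewrite (eq_bigl (fun x => (x \in A) && E y x && (x \in I))); last first.
    by move=> x; rewrite inE symE yA andbAC.
  by rewrite lerDl sumr_ge0 // => x _; rewrite invr_ge0 ler0n.
by have := cardsID I A; lia.
Qed.

(** * Counting subsets by size and by intersection with a fixed set *)

Lemma card_subsets_size (T : finType) (L : {set T}) (P : pred nat) :
  #|[set u : {set T} | u \subset L & P #|u|]|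
  = (\sum_(0 <= k < #|L|.+1 | P k) 'C(#|L|, k))%N.
Proof.
rewrite big_mkord -sum1_card.
rewrite (partition_big (fun u : {set T} => inord #|u| : 'I_#|L|.+1)
  (fun k => P (val k))) /=; last first.
  by move=> u; rewrite inE => /andP[uL Pu]; rewrite inordK // ltnS subset_leq_card.
apply: eq_bigr => k Pk; rewrite -cards_draws -[RHS]sum1_card.
apply: eq_bigl => u; rewrite !inE.
case uL: (u \subset L) => //=.
rewrite -(inj_eq val_inj) /= inordK ?ltnS ?subset_leq_card //.
by apply/andP/eqP => [[_ /eqP//]|->]; rewrite Pk.
Qed.

Lemma card_sets_split (T : finType) (L : {set T}) (P Q : pred nat) :
  #|[set x : {set T} | P #|x :&: L| & Q #|x :\: L|]|
  = ((\sum_(0 <= j < #|L|.+1 | P j) 'C(#|L|, j)) *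
     (\sum_(0 <= k < #|~: L|.+1 | Q k) 'C(#|~: L|, k)))%N.
Proof.
rewrite -!card_subsets_size -cardsX.
pose h (x : {set T}) := (x :&: L, x :\: L).
have hinj : injective h.
  by move=> x y [xyI xyD]; rewrite -(finset.setID x L) -(finset.setID y L) xyI xyD.
rewrite -(card_imset _ hinj); apply: eq_card => -[u v]; rewrite !inE /=.
apply/imsetP/idP => [[x]|/andP[/andP[uL Pu] /andP[vL Qv]]].
  rewrite inE => /andP[Px Qx] [-> ->].
  by rewrite subsetIr Px Qx finset.setDE subsetIr.
have uvI : (u :|: v) :&: L = u.
  rewrite finset.setIUl (finset.setIidPl uL); apply/finset.setUidPl.
  have -> : v :&: L = finset.set0.
    apply/setP => i; rewrite !inE; have /fintype.subsetP/(_ i) := vL.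
    by rewrite inE; case: (i \in v); case: (i \in L) => // /(_ isT).
  exact: finset.sub0set.
have uvD : (u :|: v) :\: L = v.
  rewrite finset.setDUl; have := uL; rewrite -finset.setD_eq0 => /eqP ->.
  by rewrite finset.set0U finset.setDE; apply/finset.setIidPl.
by exists (u :|: v); rewrite ?inE /h uvI uvD ?Pu.
Qed.

(** The sum factorizes over the points of [T]: a point of [D] contributes [1/2 + 1], any other point
    2. *)
Lemma sum_half_pow_cardI (F : numFieldType) (T : finType) (D : {set T}) :
  \sum_(L : {set T}) 2^-1 ^+ #|L :&: D| = 2 ^+ #|T| * (3 / 4) ^+ #|D| :> F.
Proof.
transitivity (\prod_(i : T) ((if i \in D then 2^-1 else 1) + 1 : F)).
  rewrite bigA_distr; apply: eq_bigr => L _.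
  rewrite (bigID (mem (L :&: D))) /= [X in _ * X]big1 ?mulr1; last first.
    by move=> i; rewrite inE; case: (i \in L); case: (i \in D).
  by rewrite -prodr_const; apply: eq_bigr => i; rewrite inE => /andP[-> ->].
rewrite (bigID (mem D)) /= (eq_bigr (fun=> 3 / 2)); last first.
  by move=> i ->; field.
rewrite [X in _ * X](eq_bigr (fun=> 2)); last by move=> i /negbTE ->.
rewrite !prodr_const -(cardC (mem D)) exprD.
rewrite (_ : (3 / 2 : F) = 2 * (3 / 4)); last by field.
by rewrite exprMn; ring.
Qed.

(** * Binomial coefficients near and below the middle level *)

Lemma sum_bin_pascal (F : numFieldType) (r : nat) (f : nat -> F) :
  \sum_(0 <= k < r.+2) 'C(r.+1, k)%:R * f k
  = \sum_(0 <= k < r.+1) 'C(r, k)%:R * (f k + f k.+1).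
Proof.
rewrite big_nat_recl //= bin0.
under eq_bigr do rewrite binS natrD mulrDl.
rewrite big_split /= (eq_bigr _ (fun k _ => mulrDr _ _ _)) big_split /= addrA.
congr (_ + _).
rewrite [RHS]big_nat_recl // bin0; congr (_ + _).
by rewrite big_nat_recr //= bin_small // mul0r addr0.
Qed.

(** A sum of [r] independent signs has variance [r]. In the induction the two successors of [2k - r]
    have squares adding up to [2 (2k - r)^2 + 2]. *)
Lemma binomial_second_moment (F : numFieldType) (r : nat) :
  \sum_(0 <= k < r.+1) 'C(r, k)%:R * (2 * k%:R - r%:R) ^+ 2
  = r%:R * 2 ^+ r :> F.
Proof.
elim: r => [|r IH]; first by rewrite big_nat1 /=; ring.
rewrite sum_bin_pascal.
rewrite (eq_bigr (fun k => 'C(r, k)%:R * (2 * (2 * k%:R - r%:R) ^+ 2 + 2)));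
  last first.
  by move=> k _; congr (_ * _); rewrite -!natr1; ring.
under eq_bigr do rewrite mulrDr mulrCA.
rewrite big_split /= -mulr_sumr IH -mulr_suml -natr_sum.
rewrite (_ : (\sum_(0 <= k < r.+1) 'C(r, k))%N = (2 ^ r)%N); last first.
  by rewrite big_mkord (Pascal 1 1); apply: eq_bigr => i _; rewrite !exp1n !muln1.
by rewrite natrX exprS -natr1; ring.
Qed.

(** Chebyshev's inequality: outside the window [(2k - r)^2 >= 4 m^2], so the second moment leaves
    there at most a proportion [r / (4 m^2) <= 1/2]. *)
Lemma central_binomial_window (r m : nat) : (0 < m)%N -> (r <= 2 * m ^ 2)%N ->
  (2 ^ r <= 2 * \sum_(0 <= k < r.+1 | (r <= 2 * k + 2 * m) &&
                                      (2 * k <= r + 2 * m)) 'C(r, k))%N.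
Proof.
move=> m0 rm; pose W k := (r <= 2 * k + 2 * m)%N && (2 * k <= r + 2 * m)%N.
have tot : (\sum_(0 <= k < r.+1) 'C(r, k) = 2 ^ r)%N.
  by rewrite big_mkord (Pascal 1 1); apply: eq_bigr => i _; rewrite !exp1n !muln1.
rewrite (bigID W) /= in tot; set S := (X in (2 * X)%N).
set S' := (X in (_ + X)%N) in tot.
have {}tot : (S + S' = 2 ^ r)%N := tot.
have cheb : ((4 * m ^ 2) * S' <= r * 2 ^ r)%N.
  rewrite -(ler_nat rat) !natrM (natrX _ 2 r) -(binomial_second_moment rat r).
  rewrite [leRHS](bigID W) /= -[leLHS]add0r lerD ?sumr_ge0 //.
    by move=> k _; rewrite mulr_ge0 ?ler0n ?sqr_ge0.
  rewrite /S' natr_sum mulr_sumr ler_sum // => k Wk.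
  rewrite mulrC ler_wpM2l ?ler0n // -subr_ge0.
  have : 2 * m%:R <= 2 * k%:R - r%:R :> rat \/
         2 * m%:R <= r%:R - 2 * k%:R :> rat.
    case/nandP: Wk => Wk; [right|left]; rewrite lerBrDr -!natrM -natrD ler_nat; lia.
  have := ler0n rat m; move: (m%:R : rat) (k%:R : rat) (r%:R : rat) => a b c.
  by move=> a0 [] h; nra.
have : (2 * S' <= 2 ^ r)%N.
  rewrite -(leq_pmul2l (_ : 0 < 2 * m ^ 2)%N); last by rewrite muln_gt0 expn_gt0 m0.
  by apply: leq_trans (leq_mul rm (leqnn _)); apply: leq_trans cheb; lia.
lia.
Qed.

(** The reflection of [k] to [r - k] carries the part of the window above [r / 2] into the part
    below. *)
Lemma lower_binomial_window (r m : nat) : (0 < m)%N -> (r <= 2 * m ^ 2)%N ->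
  (2 ^ r <= 4 * \sum_(0 <= k < r.+1 | (r <= 2 * k + 2 * m) &&
                                      (2 * k <= r)) 'C(r, k))%N.
Proof.
move=> m0 rm; have := central_binomial_window m0 rm.
rewrite (bigID (fun k => 2 * k <= r)%N) /=.
set S1 := (X in (2 * (X + _))%N); set S2 := (X in (2 * (_ + X))%N).
set S := (X in (4 * X)%N).
have -> : S1 = S by apply: eq_bigl => k; lia.
suff: (S2 <= S)%N by lia.
rewrite /S2 !big_mkord (reindex_inj rev_ord_inj) /= /S big_mkord.
rewrite [leqRHS](bigID (fun k : 'I__ => 2 * k < r)%N) /=.
apply: leq_trans (leq_addr _ _); apply: eq_leq.
apply: eq_big => [k|k _]; first by have := ltn_ord k; lia.
by rewrite subSS bin_sub // -ltnS.
Qed.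

(* Each step down from a level near [r / 2] costs at most a factor [1 + 16T/r],
   so shifting the lower half of the central window down by [T] levels costs at
   most [exp (16T^2/r)]. *)
Lemma binomial_step (F : realFieldType) (r T j : nat) :
    (0 < r)%N -> (8 * T <= r)%N -> (r <= 2 * j + 4 * T)%N ->
  'C(r, j.+1)%:R <= (1 + 16 * T%:R / r%:R) * 'C(r, j)%:R :> F.
Proof.
move=> r0 Tr jr; have r0' : 0 < r%:R :> F by rewrite ltr0n.
have E : j.+1%:R * 'C(r, j.+1)%:R = (r - j)%:R * 'C(r, j)%:R :> F.
  by rewrite -!natrM mul_bin_left.
rewrite -(ler_pM2l (_ : 0 < j.+1%:R :> F)) ?ltr0n // E mulrA.
apply: ler_wpM2r; first exact: ler0n.
rewrite -(ler_pM2l r0') (_ : _ * (j.+1%:R * _) = j.+1%:R * (r%:R + 16 * T%:R));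
  last by field; rewrite gt_eqF.
rewrite -!natrM -natrD -natrM ler_nat.
(* For [j > r] the truncated [r - j] is 0. Otherwise the worst case [j = r/2 - 2T] asks for
   [32 T^2 <= 4 T r], which follows from [8 T <= r]. *)
have [jr'|/ltnW jr'] := leqP j r; last by rewrite (eqP jr') muln0.
nia.
Qed.

Lemma binomial_shift (F : realFieldType) (r T k t : nat) :
    (0 < r)%N -> (8 * T <= r)%N -> (r <= 2 * k + 4 * T)%N ->
  'C(r, k + t)%:R <= (1 + 16 * T%:R / r%:R) ^+ t * 'C(r, k)%:R :> F.
Proof.
move=> r0 Tr kr; elim: t => [|t IH]; first by rewrite addn0 mul1r.
rewrite addnS exprS -mulrA.
apply: le_trans (binomial_step _ r0 Tr (_ : r <= 2 * (k + t) + 4 * T)%N) _.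
  by lia.
by apply: ler_wpM2l => //; rewrite addr_ge0 // divr_ge0 ?mulr_ge0 ?ler0n.
Qed.

Lemma binomial_lower_tail (R : realType) (r T : nat) :
    (0 < T)%N -> (8 * T <= r)%N -> (r <= 2 * T ^ 2)%N ->
  2 ^+ r <= 4 * expR (16 * T%:R ^+ 2 / r%:R) *
    (\sum_(0 <= k < r.+1 | 2 * k + 2 * T <= r) 'C(r, k))%N%:R :> R.
Proof.
move=> T0 Tr rT; have r0 : (0 < r)%N by lia.
have := lower_binomial_window T0 rT; rewrite -(ler_nat R) natrX natrM => h.
apply: (le_trans h); rewrite -[leRHS]mulrA ler_wpM2l //.
(* Levels [k < T] lie outside the window because [8 T <= r]; the others are written [k + T]. *)
rewrite (big_cat_nat _ (_ : T <= r.+1)%N) //=; last lia.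
rewrite big_nat_cond big_pred0 ?add0n; last by move=> k; lia.
rewrite -{1}[T]add0n big_addn natr_sum.
rewrite (big_cat_nat _ (leq_subr T r.+1)) //= natrD natr_sum mulrDr.
rewrite -[leLHS]addr0 lerD ?mulr_ge0 ?expR_ge0 ?ler0n // mulr_sumr.
have -> : \sum_(0 <= k < r.+1 - T | (2 * k + 2 * T <= r)%N)
    expR (16 * T%:R ^+ 2 / r%:R) * 'C(r, k)%:R =
  \sum_(0 <= k < r.+1 - T | (2 * (k + T) <= r)%N)
    expR (16 * T%:R ^+ 2 / r%:R) * 'C(r, k)%:R :> R.
  by apply: eq_bigl => k; lia.
rewrite [leRHS](bigID (fun k => r <= 2 * (k + T) + 2 * T)%N) /=.
rewrite -[leLHS]addr0 lerD //; last first.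
  by apply: sumr_ge0 => k _; rewrite mulr_ge0 ?expR_ge0.
rewrite (eq_bigl _ _ (fun k => andbC _ _)); apply: ler_sum => k /andP[_ kr].
apply: le_trans (binomial_shift _ _ r0 Tr (_ : r <= 2 * k + 4 * T)%N) _; first lia.
apply: ler_wpM2r => //.
rewrite (_ : 16 * T%:R ^+ 2 / r%:R = T%:R * (16 * T%:R / r%:R)); last first.
  by field; rewrite pnatr_eq0 -lt0n.
rewrite expRM_natl; apply: lerXn2r; rewrite ?nnegrE ?expR_ge0 ?expR_ge1Dx //.
Qed.

(** * The hidden families: few sets [L] per disjoint pair, yet far from intersecting *)

(** The support of [f_L], with both inequalities doubled so that halves stay exact in [nat]. *)
Definition hidden_family (T : finType) (m : nat) (L : {set T}) : {set {set T}} :=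
  [set x : {set T} | (#|L| <= 2 * #|x :&: L| + 2 * m)%N
                   & (2 * #|x| + 14 * m <= #|T|)%N].

Lemma hidden_family_disjoint_pair (F : realFieldType) (T : finType) (m : nat)
    (x y : {set T}) : x :&: y = finset.set0 ->
  #|[set L : {set T} | (x \in hidden_family m L) && (y \in hidden_family m L)]|%:R
    * 14 ^+ m <= 2 ^+ #|T| :> F.
Proof.
move=> xy0; set S := finset _; pose D := ~: (x :|: y).
have cardxy : (#|x :|: y| = #|x| + #|y|)%N by rewrite cardsU xy0 cards0 subn0.
have cardD : (#|x| + #|y| + #|D| = #|T|)%N by rewrite -cardxy cardsC.
(* An empty [S] is trivial; otherwise any member [L0] supplies the bounds on [#|x|] and [#|y|] that
   make [D] large. *)
have [->|[L0 L0S]] := set_0Vmem S; first by rewrite cards0 mul0r exprn_ge0.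
have D14 : (14 * m <= #|D|)%N by move: L0S; rewrite !inE; lia.
have SD L : L \in S -> (#|L :&: D| <= 2 * m)%N.
  rewrite !inE => /andP[/andP[hx _] /andP[hy _]].
  have := cardsID (x :|: y) L; rewrite finset.setDE -/D finset.setIUr cardsU.
  have -> : (L :&: x) :&: (L :&: y) = finset.set0.
    by rewrite finset.setIACA finset.setIid xy0 finset.setI0.
  by rewrite cards0 ![L :&: _]finset.setIC [D :&: _]finset.setIC; lia.
(* Markov's inequality for [2 ^ - |L & D|]. *)
have key : #|S|%:R * 2^-1 ^+ (2 * m) <= 2 ^+ #|T| * (3 / 4) ^+ (14 * m) :> F.
  rewrite mulr_natl -sumr_const.
  apply: le_trans (_ : \sum_(L : {set T}) 2^-1 ^+ #|L :&: D| <= _).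
    rewrite [leRHS](bigID (mem S)) /= -[leLHS]addr0 lerD //; last first.
      by apply: sumr_ge0 => L _; rewrite exprn_ge0 // invr_ge0.
    apply: ler_sum => L LS; apply: ler_wiXn2l (SD _ LS); first by rewrite invr_ge0.
    by rewrite invf_le1 // ler1n.
  rewrite sum_half_pow_cardI ler_wpM2l ?exprn_ge0 //.
  by apply: ler_wiXn2l D14; lra.
(* The constant 14 works because [56 (3/4)^14 < 1]. *)
have e4 : 14 ^+ m = 2^-1 ^+ (2 * m) * 56 ^+ m :> F.
  by rewrite exprM -exprMn; congr (_ ^+ m); field.
rewrite e4 mulrA; apply: le_trans (ler_wpM2r _ key) _; first by rewrite exprn_ge0.
rewrite -mulrA exprM -exprMn ler_piMr ?exprn_ge0 // exprn_ile1 //; last by lra.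
Qed.

(** The constant 16 collects a factor 2 for the central window inside [L], 4 for the lower tail
    outside [L], and 2 for the half of the graph that [I] may occupy. *)
Lemma hidden_family_far (R : realType) (T : finType) (m : nat) (L : {set T})
    (I : {set {set T}}) :
    (0 < m)%N -> (#|T| <= 4 * m ^ 2)%N -> (128 * m <= #|T|)%N ->
    (2 * #|L| <= #|T|)%N -> {in I &, forall x y, x :&: y != finset.set0} ->
  2 ^+ #|T| <= 16 * expR (2048 * m%:R ^+ 2 / #|T|%:R) *
    #|hidden_family m L :\: I|%:R :> R.
Proof.
move=> m0 nm mn Ln intI.
have cardL : (#|L| + #|~: L| = #|T|)%N by rewrite cardsC.
(* [P] is two-sided so that complementing inside [L] preserves it. The [16m] of [Q] loses [2m] to
   the upper bound in [P], leaving the [14m] of [hidden_family]. *)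
pose P j := (#|L| <= 2 * j + 2 * m)%N && (2 * j <= #|L| + 2 * m)%N.
pose Q k := (2 * k + 2 * (8 * m) <= #|~: L|)%N.
pose A := [set x : {set T} | P #|x :&: L| & Q #|x :\: L|].
pose E (x y : {set T}) := [&& y :&: L == L :\: x, (y :\: L) :&: x == finset.set0
   & #|y :\: L| == #|x :\: L|].
have symE : symmetric E.
  suff impl x y : E x y -> E y x by move=> x y; apply/idP/idP; apply: impl.
  case/and3P => /eqP h1 /eqP h2 h3; rewrite /E (eqP h3) eqxx andbT.
  have e1 i : (i \in y) && (i \in L) = (i \notin x) && (i \in L).
    by have := congr1 (fun s : {set T} => i \in s) h1; rewrite !inE.
  have e2 i : (i \notin L) && (i \in y) && (i \in x) = false.
    by have := congr1 (fun s : {set T} => i \in s) h2; rewrite !inE.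
  apply/andP; split; apply/eqP/setP => i; rewrite !inE; have := e1 i; have := e2 i;
    by case: (i \in L); case: (i \in x); case: (i \in y).
(* A neighbour is determined by its part outside [L], any set of size [#|x :\: L|] avoiding [x] and
   [L], and lies in [A] automatically. The degree thus depends only on that size, which edges
   preserve. *)
have degE x : x \in A ->
    #|[set y in A | E x y]| = 'C(#|~: L| - #|x :\: L|, #|x :\: L|).
  rewrite inE => /andP[/andP[P1 P2] Qx].
  have -> : (#|~: L| - #|x :\: L| = #|~: (L :|: x)|)%N.
    have := cardsC (L :|: x); have := cardsUI L x; have := cardsID L x.
    by rewrite [x :&: L]finset.setIC; lia.
  have xL : #|L :\: x| = (#|L| - #|x :&: L|)%N by rewrite cardsD finset.setIC.
  rewrite -cards_draws.
  pose h (z : {set T}) := (L :\: x) :|: z.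
  have hI (z : {set T}) : z \subset ~: (L :|: x) ->
      h z :&: L = L :\: x /\ h z :\: L = z.
    move/fintype.subsetP => zLx; split; apply/setP => i; have := zLx i; rewrite !inE;
      case: (i \in L); case: (i \in x); case: (i \in z) => //= H; by have := H isT.
  rewrite -[RHS](card_in_imset (f := h)); last first.
    move=> z1 z2; rewrite !inE => /andP[/hI[_ z1E] _] /andP[/hI[_ z2E] _] hz.
    by rewrite -z1E -z2E hz.
  apply: eq_card => y; apply/idP/imsetP => [|[z]].
    rewrite inE => /andP[yA /and3P[/eqP yL /eqP yx yk]].
    exists (y :\: L); last by rewrite /h -yL finset.setID.
    rewrite inE yk andbT; apply/fintype.subsetP => i iy; rewrite !inE negb_or.
    have := congr1 (fun s : {set T} => i \in s) yx; move: iy; rewrite !inE.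
    by case: (i \in L); case: (i \in x); case: (i \in y).
  rewrite inE => /andP[zLx zk] ->; have [hL hD] := hI _ zLx.
  rewrite !inE /E hL hD zk eqxx (eqP zk) Qx xL /P !andbT /=.
  apply/andP; split; first by have := subset_leq_card (subsetIr x L); lia.
  apply/eqP/setP => i; have /fintype.subsetP/(_ i) := zLx; rewrite !inE.
  by case: (i \in z); case: (i \in x); rewrite ?orbT //= => /(_ isT).
have AI : (#|A| <= 2 * #|A :\: I|)%N.
  apply: (independent_set_le_half symE) => [x xA|x y xA yA|x y xI yI].
  - by rewrite degE // bin_gt0; move: xA; rewrite inE /Q => /andP[_]; lia.
  - by rewrite !degE // => /and3P[_ _ /eqP ->].
  apply: contra (intI _ _ xI yI) => /and3P[/eqP yL /eqP yx _].
  apply/eqP/setP => i; rewrite !inE.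
  have := congr1 (fun s : {set T} => i \in s) yx.
  have := congr1 (fun s : {set T} => i \in s) yL; rewrite !inE.
  by case: (i \in L); case: (i \in x); case: (i \in y).
have AF : A \subset hidden_family m L.
  apply/fintype.subsetP => x; rewrite !inE => /andP[/andP[P1 P2] Qx]; rewrite P1 /=.
  by rewrite -(cardsID L x); move: P2 Qx; rewrite /Q -cardL => *; lia.
have AFI : (#|A :\: I| <= #|hidden_family m L :\: I|)%N.
  exact: subset_leq_card (finset.setSD I AF).
have cA : #|A| = _ := card_sets_split L P Q.
have h1 : (2 ^ #|L| <= 2 * \sum_(0 <= j < #|L|.+1 | P j) 'C(#|L|, j))%N.
  by apply: central_binomial_window => //; lia.
have h2 := @binomial_lower_tail R #|~: L| (8 * m) _ _ _.
have {h2} := h2 (ltac:(lia)) (ltac:(lia)) (ltac:(lia)).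
set e1 := expR _; set S2 := (\sum_(0 <= k < _ | _) _)%N => h2.
rewrite -/S2 in cA.
set e2 := expR _.
(* Here [16 (8m)^2 = 1024 m^2], and [#|~: L|] is at least half of [#|T|], whence 2048. *)
have e12 : e1 <= e2.
  rewrite ler_expR natrM ler_pdivrMr ?ltr0n; last lia.
  rewrite mulrAC ler_pdivlMr ?ltr0n; last lia.
  have : #|T|%:R <= 2 * #|~: L|%:R :> R by rewrite -natrM ler_nat; lia.
  have := sqr_ge0 (m%:R : R); move: (m%:R : R) => a; nra.
have {}h1 : 2 ^+ #|L| <= 2 * (\sum_(0 <= j < #|L|.+1 | P j) 'C(#|L|, j))%N%:R :> R.
  by rewrite -natrX -natrM ler_nat.
rewrite -cardL exprD.
apply: le_trans (ler_pM _ _ h1 h2) _; rewrite ?exprn_ge0 //.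
apply: le_trans (_ : 8 * e2 * #|A|%:R <= _).
  rewrite cA natrM; have := ler0n R S2.
  have := ler0n R (\sum_(0 <= j < #|L|.+1 | P j) 'C(#|L|, j))%N.
  move: (_%:R) (S2%:R) => a b a0 b0.
  rewrite [leLHS](_ : _ = 8 * e1 * (a * b)); last ring.
  by rewrite ler_wpM2r ?mulr_ge0 // ler_wpM2l.
have : #|A|%:R <= 2 * #|hidden_family m L :\: I|%:R :> R.
  by rewrite -natrM ler_nat; lia.
by have := expR_ge0 (2048 * m%:R ^+ 2 / #|T|%:R : R); rewrite -/e2 => e0; nra.
Qed.

(** * From the hidden families to a bound on queries *)

Lemma run_eq_queries (n : nat) (t : query_tree n) (f g : cube n -> bool) :
  {in queries t f, f =1 g} -> run t f = run t g.
Proof.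
elim: t => [//|x k IH] /= fg; rewrite -fg ?mem_head //.
by apply: IH => y yk; rewrite fg // inE yk orbT.
Qed.

(** The sum is the expected number of events that occur, so a pointwise bound on that number
    suffices. *)
Lemma sum_probability_le (R : realType) (d : measure_display)
    (T : measurableType d) (P : probability T R) (I : finType) (G : pred I)
    (S : I -> set T) (M : R) : (forall i, measurable (S i)) ->
    (forall w, \sum_(i | G i) \1_(S i) w <= M) ->
  (\sum_(i | G i) P (S i) <= M%:E)%E.
Proof.
move=> mS leM.
have mI i : measurable_fun [set: T] (EFin \o (\1_(S i) : T -> R)).
  by apply/measurable_EFinP; exact: measurable_indic.
rewrite (eq_bigr (fun i => \int[P]_w (\1_(S i) w)%:E)%E); last first.
  by move=> i _; rewrite integral_indic // setIT.
rewrite -big_filter -ge0_integral_sum //.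
rewrite -[leRHS]mule1 -(@probability_setT _ _ _ P) -integral_cst //.
apply: ge0_le_integral => //.
- by move=> w _; apply: sume_ge0 => i _; rewrite lee_fin.
- exact: emeasurable_sum.
- by move=> w _; rewrite sumEFin big_filter lee_fin.
Qed.

(** Complementation injects the larger sets into the smaller ones. *)
Lemma half_of_subsets_small (T : finType) :
  (2 ^ #|T| <= 2 * #|[set L : {set T} | 2 * #|L| <= #|T|]%N|)%N.
Proof.
set G := finset _.
have : (#|~: G| <= #|G|)%N.
  rewrite -(card_imset (mem (~: G)) (@finset.setC_inj T)).
  apply: subset_leq_card; apply/fintype.subsetP => _ /imsetP[L LG ->].
  by move: LG; rewrite !inE; have := cardsC L; lia.
  by have := cardsC G; rewrite -cardsT -powersetT card_powerset cardsT; lia.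
Qed.

Definition points (n : nat) (x : cube n) : {set 'I_n} := [set i | x i].

Definition hidden_function (n m : nat) (L : {set 'I_n}) (x : cube n) : bool :=
  points x \in hidden_family m L.

(** An intersecting [g] disagrees with the hidden function at every member of the family that it
    omits. *)
Lemma hidden_function_far (R : realType) (n m : nat) (eps : R) (L : {set 'I_n}) :
    (0 < m)%N -> (n <= 4 * m ^ 2)%N -> (128 * m <= n)%N -> (2 * #|L| <= n)%N ->
    0 <= eps -> eps * (16 * expR (2048 * m%:R ^+ 2 / n%:R)) <= 1 ->
  far_from_intersecting eps (hidden_function m L).
Proof.
move=> m0 nm mn Ln eps0 epsm g intg.
pose ind (S : {set 'I_n}) : cube n := [ffun i => i \in S].
have pointsK S : points (ind S) = S by apply/setP => i; rewrite inE ffunE.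
pose I := [set S | g (ind S)].
have intI : {in I &, forall x y, x :&: y != finset.set0}.
  move=> x y; rewrite !inE => gx gy; have [i] := intg _ _ gx gy.
  by rewrite !ffunE => ixy; apply/set0Pn; exists i; rewrite inE.
have := @hidden_family_far R 'I_n m L I m0; rewrite !card_ord.
move=> /(_ nm mn Ln intI); set e := expR _ in epsm *; set F := _ :\: _ => hF.
rewrite /dist card_ffun card_bool card_ord natrX ler_pdivlMr ?exprn_gt0 //.
apply: le_trans (ler_wpM2l eps0 hF) _.
rewrite mulrA; apply: le_trans (ler_wpM2r _ epsm) _; rewrite ?mul1r //.
rewrite ler_nat -(card_imset (mem F) (can_inj pointsK)).
apply: subset_leq_card; apply/fintype.subsetP => _ /imsetP[S SF ->].
by move: SF; rewrite !inE /hidden_function pointsK !inE => /andP[/negbTE -> ->].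
Qed.

(** Double counting over small [L]: the rejections of the hidden functions have total probability at
    least [(2/3) 2^(n-1)], while outside a null set each sample has at most [q^2] pairs of queries,
    each exposing at most [2^n / 14^m] sets [L]. *)
Lemma one_sided_nonadaptive_query_bound (R : realType) (n m q : nat) (eps : R)
    (d : measure_display) (T : measurableType d) (P : probability T R)
    (A : T -> query_tree n) :
    (0 < m)%N -> (n <= 4 * m ^ 2)%N -> (128 * m <= n)%N ->
    0 <= eps -> eps * (16 * expR (2048 * m%:R ^+ 2 / n%:R)) <= 1 ->
    tester P eps A -> one_sided P A -> nonadaptive A -> makes_at_most q A ->
  (2 ^ m <= q)%N.
Proof.
move=> m0 nm mn eps0 epsm [mA _ rejA] oneA nonA qA.
have rejE f : rejects A f = (~` accepts A f)%classic.
  by apply/seteqP; split => w /=; rewrite /rejects /accepts /=; case: run.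
have mR f : measurable (rejects A f) by rewrite rejE; exact: measurableC.
(* One-sidedness holds only almost surely for each function. As there are finitely many functions,
   [N] is null, and outside it every intersecting function is accepted. *)
pose N := \big[setU/set0]_(f : {ffun cube n -> bool} | `[< intersecting f >])
  rejects A f.
have [mN PN] : measurable N /\ P N = 0%E.
  rewrite /N; apply: (big_ind (fun X => measurable X /\ P X = 0%E)).
  - by split; [exact: measurable0|exact: measure0].
  - move=> X Y [mX X0] [mY Y0]; split; first exact: measurableU.
    by rewrite -X0; exact: measureU0.
  - move=> f /asboolP intf; split=> //.
    by rewrite rejE probability_setC // oneA // subee.
pose S L := (rejects A (hidden_function m L) `\` N)%classic.
have mS L : measurable (S L) by exact: measurableD.
(* By non-adaptivity the list taken at the zero function is the query list for every function. *)
pose Q w := queries (A w) (fun=> false).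
have SQ L w : S L w -> exists x y, [/\ x \in Q w, y \in Q w,
    points x :&: points y = finset.set0,
    points x \in hidden_family m L & points y \in hidden_family m L].
  case=> rejw Nw.
  (* The hidden function erased off the queried points gets the same answers and is rejected too;
     outside [N] it therefore cannot be intersecting. *)
  pose f : {ffun cube n -> bool} :=
    [ffun x => (x \in Q w) && hidden_function m L x].
  have runf : run (A w) f = false.
    rewrite -rejw; apply/esym/run_eq_queries => x.
    by rewrite (nonA w _ (fun=> false)) => xQ; rewrite ffunE xQ.
  have nintf : ~ intersecting f.
    move=> intf; apply: Nw; rewrite /N (bigD1 f) /=; last exact/asboolP.
    by left.
  apply: contrapT => nex; apply: nintf => x y; rewrite !ffunE.
  move=> /andP[xQ xF] /andP[yQ yF]; apply: contrapT => nxy; apply: nex.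
  exists x, y; split => //; apply/setP => i; rewrite !inE.
  by apply/negP => xyi; apply: nxy; exists i.
pose G := [set L : {set 'I_n} | (2 * #|L| <= n)%N].
pose B : R := 2 ^+ n / 14 ^+ m.
have B0 : 0 <= B by rewrite divr_ge0 ?exprn_ge0.
pose pair (x y : cube n) (L : {set 'I_n}) : R :=
  ((points x :&: points y == finset.set0) &&
  ((points x \in hidden_family m L) && (points y \in hidden_family m L)))%:R.
have pairB (x y : cube n) : \sum_(L : {set 'I_n}) pair x y L <= B.
  rewrite /pair; have [xy0|_] := eqVneq; last by rewrite big1.
  rewrite /B ler_pdivlMr ?exprn_gt0 // -natr_sum.
  rewrite -[in leRHS](card_ord n).
  apply: le_trans (hidden_family_disjoint_pair R m xy0).
  rewrite ler_wpM2r ?exprn_ge0 // ler_nat -sum1_card [leqRHS]big_mkcond /=.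
  by apply: leq_sum => L _; rewrite [in leqRHS]inE; case: (_ && _).
have term_le (s : seq (cube n)) (f : cube n -> R) x :
    (forall y, 0 <= f y) -> x \in s -> f x <= \sum_(y <- s) f y.
  by move=> f0 xs; rewrite (big_rem x) //= lerDl sumr_ge0.
have sumS w : \sum_(L in G) \1_(S L) w <= q%:R ^+ 2 * B.
  apply: le_trans (_ : \sum_(L : {set 'I_n}) \sum_(x <- Q w) \sum_(y <- Q w)
      pair x y L <= _).
    have pos L x : 0 <= \sum_(y <- Q w) pair x y L.
      by apply: sumr_ge0 => y _; exact: ler0n.
    rewrite [leRHS](bigID (mem G)) /= -[leLHS]addr0 lerD //; last first.
      by apply: sumr_ge0 => L _; apply: sumr_ge0.
    apply: ler_sum => L _; rewrite indicE.
    have [/set_mem/SQ[x [y [xQ yQ xy0 xF yF]]]|_] := boolP (w \in S L); last first.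
      exact: sumr_ge0.
    apply: le_trans (term_le _ (fun x => \sum_(y <- Q w) pair x y L) _ (pos L) xQ).
    apply: le_trans (term_le _ (fun y => pair x y L) _ _ yQ).
      by rewrite /pair xy0 eqxx xF yF.
    by move=> z; exact: ler0n.
  rewrite exchange_big /=.
  apply: le_trans (_ : \sum_(x <- Q w) \sum_(y <- Q w) B <= _).
    by apply: ler_sum => x _; rewrite exchange_big /=; apply: ler_sum.
  rewrite !big_const_seq !count_predT !iter_addr_0 -mulrnA -[leLHS]mulr_natl.
  by rewrite ler_wpM2r // -natrX ler_nat leq_mul ?qA.
have lowS L : L \in G -> ((2 / 3)%:E <= P (S L))%E.
  rewrite inE => Ln; have far := hidden_function_far m0 nm mn Ln eps0 epsm.
  apply: le_trans (rejA _ far) _.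
  rewrite (measureDI P (mR _) mN) [X in (_ + X)%E](subset_measure0 _ mN _ PN).
  - by rewrite adde0.
  - exact: measurableI.
  - exact: subIsetr.
have : ((\sum_(L in G) (2 / 3))%:E <= (q%:R ^+ 2 * B)%:E)%E.
  apply: le_trans (sum_probability_le P (G := mem G) mS sumS).
  by rewrite -sumEFin; exact: lee_sum.
rewrite lee_fin sumr_const -[leLHS]mulr_natr /B mulrA ler_pdivlMr ?exprn_gt0 // => h.
have hG : 2 ^+ n <= 2 * #|G|%:R :> R.
  rewrite -natrX -natrM ler_nat.
  by have := half_of_subsets_small 'I_n; rewrite card_ord.
have h14 : 14 ^+ m <= 3 * q%:R ^+ 2 :> R.
  have p1 : 0 < 2 ^+ n :> R by exact: exprn_gt0.
  have p2 : 0 < 14 ^+ m :> R by exact: exprn_gt0.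
  rewrite -(ler_pM2r p1); move: h (ler_wpM2l (ltW p2) hG).
  move: (2 ^+ n) (14 ^+ m) (#|G|%:R) (q%:R ^+ 2) => a b c z; nra.
have {}h14 : (14 ^ m <= 3 * q ^ 2)%N by rewrite -(ler_nat R) natrM !natrX.
(* At [m = 1] this is [12 <= 14]. The factor 3 then cancels, and [4 ^ m] is the square of
   [2 ^ m]. *)
have h3 : (3 * 4 ^ m <= 14 ^ m)%N.
  case: m m0 {nm mn epsm S SQ mS B B0 pair pairB term_le sumS lowS h hG h14}
    => // m _.
  rewrite !expnS mulnA; apply: leq_mul => //.
  by case: m => [|m] //; rewrite leq_exp2r.
rewrite -(@leq_exp2r _ _ 2) // -expnM mulnC expnM -(leq_pmul2l (_ : 0 < 3)%N) //.
exact: leq_trans h3 h14.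
Qed.

(** * Choice of the constants and of [m] *)

Lemma ln2_ge_half (R : realType) : 2^-1 <= ln 2 :> R.
Proof.
have h : ln (1 + - 2^-1 : R) <= - 2^-1 by apply: le_ln1Dx; lra.
have e : 1 + - 2^-1 = 2^-1 :> R by lra.
by move: h; rewrite e lnV ?posrE // lerN2.
Qed.

Theorem theorem1p3 (R : realType) :
  exists c K : R,
    [/\ 0 < c, 0 < K &
      forall (n : nat) (eps : R), 2 ^- n <= eps -> eps < c ->
      forall (d : measure_display) (T : measurableType d)
             (P : probability T R) (A : T -> query_tree n) (q : nat),
        tester P eps A -> one_sided P A -> nonadaptive A ->
        makes_at_most q A ->
        2 `^ (K * Num.sqrt (n%:R * log2 (1 / eps))) <= q%:R].
Proof.
(* With [m] the integer part of [s / a], the value 128 gives [128 m <= s <= n]. The bound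
   [eps < 2 ^ -(a^2)] gives [a^2 <= lam], hence [n <= (s / a)^2]. The factor 1/2 in [K] pays for the
   rounding. *)
pose a : R := 128.
exists (expR (- (a ^+ 2) * ln 2)), (2^-1 / a).
split; first exact: expR_gt0; first by rewrite /a; lra.
move=> n eps eps_ge eps_lt d T P A q testA oneA nonA qA.
have eps0 : 0 < eps by apply: lt_le_trans eps_ge; rewrite invr_gt0 exprn_gt0.
have l2 := ln2_ge_half R; have l20 : 0 < ln 2 :> R by lra.
set lam := log2 (1 / eps).
have lamE : lam * ln 2 = - ln eps.
  by rewrite /lam /log2 div1r lnV ?posrE // mulrVK // unitfE gt_eqF.
have lam_n : lam <= n%:R.
  rewrite -(ler_pM2r l20) lamE.
  have : ln (2 ^- n) <= ln eps by rewrite ler_ln ?posrE // invr_gt0 exprn_gt0.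
  by rewrite lnV ?posrE ?exprn_gt0 // lnXn // mulr_natl; lra.
have lam_a : a ^+ 2 <= lam.
  rewrite -(ler_pM2r l20) lamE lerNr -mulNr -[leRHS]expRK.
  by rewrite ler_ln ?posrE ?expR_gt0 ?ltW.
have a2 : a ^+ 2 = 16384 by rewrite /a; ring.
set s := Num.sqrt _.
have s2 : s ^+ 2 = n%:R * lam by rewrite sqr_sqrtr // mulr_ge0 //; lra.
have s0 : 0 <= s by exact: sqrtr_ge0.
pose u := s / a; pose m := Num.trunc u.
have u0 : 0 <= u by rewrite divr_ge0.
have sE : s = 128 * u by rewrite /u /a; field.
have u_n : n%:R <= u ^+ 2.
  move: s2; rewrite sE; have := ler0n R n; move: lam_a; rewrite a2; nra.
(* This comes from [a^2 <= lam <= n <= u^2]. *)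
have u_128 : 128 <= u by rewrite leNgt; apply/negP => hu; nra.
have /andP[mu um] := truncn_itv u0; rewrite -/m in mu um.
have mu2 : u / 2 <= m%:R by move: um; rewrite -natr1; lra.
have m0 : (0 < m)%N by rewrite -(ltr0n R); lra.
have n0 : 0 < n%:R :> R by lra.
have nm : (n <= 4 * m ^ 2)%N by rewrite -(ler_nat R) natrM natrX; nra.
have s_n : s <= n%:R by rewrite leNgt; apply/negP => hs; nra.
have mn : (128 * m <= n)%N by rewrite -(ler_nat R) natrM; lra.
have epsm : eps * (16 * expR (2048 * m%:R ^+ 2 / n%:R)) <= 1.
  have -> : eps = expR (- (lam * ln 2)) by rewrite lamE opprK lnK.
  have -> : (16 : R) = expR (4%:R * ln 2) by rewrite expRM_natl lnK ?posrE //; ring.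
  rewrite -!expRD -[leRHS]expR0 ler_expR.
  (* Since [2048 = 128^2 / 8] and [128 m <= s]. What remains, [4 ln 2 + lam / 8 <= lam ln 2],
     follows from [ln 2 >= 1/2] and [lam >= a^2]. *)
  have : 2048 * m%:R ^+ 2 / n%:R <= lam / 8.
    rewrite ler_pdivrMr //.
    have : (128 * m%:R) ^+ 2 <= n%:R * lam by rewrite -s2 ler_sqr ?nnegrE //; lra.
    by lra.
  by nra.
have mq := one_sided_nonadaptive_query_bound m0 nm mn (ltW eps0) epsm testA oneA
  nonA qA.
apply: le_trans (_ : 2 `^ m%:R <= _).
  by apply: ler_powR; [lra | rewrite /u in mu2; lra].
by rewrite powR_mulrn // -natrX ler_nat.
Qed.
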